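(* Let $M=\{a_1,a_2,b_1,b_2\}\cup\{u_i,v_i: i\in\mathbb{N}\}$ (all listed points being distinct) be the metric space in which the distances between different points are as follows: for any $i\in\{1,2\}$ and $j,k,l\in\mathbb{N}$ with $k\ne l$, $$d(a_1,a_2)=d(b_1,b_2)=d(a_i,v_j)=d(b_i,u_j)=d(u_k,u_l)=d(v_k,v_l)=d(u_k,v_l)=2,$$ and for any $i,j\in\{1,2\}$ and $k\in\mathbb{N}$, $$d(a_i,b_j)=d(a_i,u_k)=d(b_i,v_k)=d(u_k,v_k)=1.$$ Then $M$ has the long trapezoid property but does not have the strong long trapezoid property. Consequently, for any choice of base point in $M$, the dual Banach space $\mathrm{Lip}_0(M)=\mathcal{F}(M)^*$ has the weak$^*$ strong diameter $2$ property but does not have the weak$^*$ symmetric strong diameter $2$ property.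
   Context: All Banach spaces are real. For a Banach space $X$, $B_X$, $S_X$, $X^*$ denote its closed unit ball, unit sphere and dual. A metric space $M$ with metric $d$ has the long trapezoid property if, for every finite subset $N$ of $M$ and every $\varepsilon>0$, there exist $u,v\in M$, $u\neq v$, such that for all $x,y\in N$ $$(1-\varepsilon)\bigl(d(x,y)+d(u,v)\bigr)\le d(x,u)+d(y,v).\qquad (A)$$ It has the strong long trapezoid property if, for every finite subset $N$ of $M$ and every $\varepsilon>0$, there exist $u,v\in M$, $u\ne v$, such that (A) holds for all $x,y\in N$ and, for all $x,y,z,w\in N$, $$(1-\varepsilon)\bigl(2d(u,v)+d(x,y)+d(z,w)\bigr)\le d(x,u)+d(y,u)+d(z,v)+d(w,v).$$ A weak$^*$ slice of $B_{X^*}$ is a set of the form $\{x^*\in B_{X^*}: \langle x,x^*\rangle>1-\alpha\}$ with $x\in S_X$ and $\alpha>0$. The dual $X^*$ has the weak$^*$ strong diameter $2$ property if every finite convex combination of weak$^*$ slices of $B_{X^*}$ has diameter $2$. It has the weak$^*$ symmetric strong diameter $2$ property if, for every finite family $(S_i)_{i=1}^n$ of weak$^*$ slices of $B_{X^*}$ and every $\varepsilon>0$, there exist $f_i\in S_i$, $i=1,\dots,n$, and $g\in B_{X^*}$ such that $f_i\pm g\in S_i$ for every $i\in\{1,\dots,n\}$ and $\|g\|>1-\varepsilon$. For a metric space $M$ with base point $0$, $\mathrm{Lip}_0(M)$ is the Banach space of all Lipschitz functions $f\colon M\to\mathbb{R}$ with $f(0)=0$, with norm $\|f\|=\sup\{|f(x)-f(y)|/d(x,y):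 x\ne y\}$. With $\langle f,\delta_m\rangle=f(m)$ for $m\in M$, the Lipschitz-free space is $\mathcal{F}(M)=\overline{\mathrm{span}}\{\delta_m: m\in M\}\subset\mathrm{Lip}_0(M)^*$, and under this duality $\mathcal{F}(M)^*$ is isometrically isomorphic to $\mathrm{Lip}_0(M)$; weak$^*$ slices of $B_{\mathrm{Lip}_0(M)}$ are with respect to the predual $\mathcal{F}(M)$. *)

(* Defs.v *)
From HB Require Import structures.
From mathcomp Require Import all_boot all_order all_algebra.
From mathcomp Require Import all_classical all_reals all_analysis.
From mathcomp Require Import ring lra.

Set Implicit Arguments.
Unset Strict Implicit.
Unset Printing Implicit Defensive.

Import Order.TTheory GRing.Theory Num.Theory.
Import numFieldNormedType.Exports.

Local Open Scope classical_set_scope.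
Local Open Scope ring_scope.

Section trapezoid_properties.
Context {R : realType} (M : metricType R).

Definition trapezoid_ineq (N : set M) (e : R) (u v : M) : Prop :=
  forall x y, N x -> N y ->
    (1 - e) * (mdist x y + mdist u v) <= mdist x u + mdist y v.

Definition long_trapezoid : Prop :=
  forall (N : set M) (e : R), finite_set N -> 0 < e ->
    exists u v : M, u <> v /\ trapezoid_ineq N e u v.

Definition strong_long_trapezoid : Prop :=
  forall (N : set M) (e : R), finite_set N -> 0 < e ->
    exists u v : M, [/\ u <> v, trapezoid_ineq N e u v &
      forall x y z w, N x -> N y -> N z -> N w ->
        (1 - e) * (2 * mdist u v + mdist x y + mdist z w)
          <= mdist x u + mdist y u + mdist z v + mdist w v].

End trapezoid_properties.

Section dual.
Context {R : realType} (X : normedModType R).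

(* The scalar field carries its module structure under the alias R^o. *)
Definition is_dual : {pred X -> R} :=
  [pred f : X -> R | `[< linear (f : X -> R^o) /\ continuous f >]].

Record dual := Dual { dual_val :> X -> R ; dual_valP : dual_val \in is_dual }.

HB.instance Definition _ := [isSub for dual_val].
HB.instance Definition _ := [Choice of dual by <:].

Let is_dual_submod : submod_closed is_dual.
Proof.
split.
  apply/asboolP; split; last exact: cst_continuous.
  by move=> a x y; rewrite /GRing.zero/= scaler0 addr0.
move=> a f g /asboolP[lf cf] /asboolP[lg cg]; apply/asboolP; split.
  move=> k x y; have /= := lf k x y; have /= := lg k x y.
  rewrite /GRing.scale/= => hg hf.
  change ((a * f (k *: x + y) + g (k *: x + y)) =
    k * (a * f x + g x) + (a * f y + g y)).
  by rewrite hf hg; ring.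
move=> x; apply: cvgD; last exact: cg.
by apply: cvgM; [exact: cvg_cst|exact: cf].
Qed.

HB.instance Definition _ := GRing.isSubmodClosed.Build R (X -> R) is_dual
  is_dual_submod.
HB.instance Definition _ := [SubChoice_isSubLmodule of dual by <:].

Implicit Types (f g : dual) (x : X).

Lemma dual_linear f : linear (f : X -> R^o).
Proof. by have /asboolP[] := dual_valP f. Qed.

Lemma dual_continuous f : continuous f.
Proof. by have /asboolP[] := dual_valP f. Qed.

HB.instance Definition _ f := GRing.isLinear.Build R X R^o _ f (dual_linear f).

Lemma dualP f g : (forall x, f x = g x) -> f = g.
Proof. by move=> fg; apply/val_inj/funext. Qed.

Lemma dual0E x : (0 : dual) x = 0. Proof. by []. Qed.
Lemma dualDE f g x : (f + g) x = f x + g x. Proof. by []. Qed.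
Lemma dualNE f x : (- f) x = - f x. Proof. by []. Qed.
Lemma dualZE (a : R) f x : (a *: f) x = a * f x. Proof. by []. Qed.

Definition opnorm f : R := sup [set `|f x| | x in [set x | `|x| <= 1]].

Lemma dual_bounded f : exists2 k, 0 <= k & forall x, `|f x| <= k * `|x|.
Proof.
have /linear_bounded_continuous/linear_boundedP/pinfty_ex_gt0[k k0 fk] :
  continuous (f : {linear X -> R^o}) by exact: dual_continuous.
by exists k; [exact: ltW|exact: fk].
Qed.

Let opnorm_has_sup f : has_sup [set `|f x| | x in [set x | `|x| <= 1]].
Proof.
have [k k0 fk] := dual_bounded f; split.
  by exists `|f 0|, 0 => //=; rewrite normr0 ler01.
exists k => _ [x /= x1 <-]; rewrite (le_trans (fk x))//.
by rewrite -[leRHS]mulr1 ler_wpM2l.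
Qed.

Let opnorm_ge0 f : 0 <= opnorm f.
Proof.
rewrite (le_trans (normr_ge0 (f 0)))//.
by apply: sup_upper_bound => //; exists 0 => //=; rewrite normr0 ler01.
Qed.

Let le_opnorm f x : `|f x| <= opnorm f * `|x|.
Proof.
have [->|x0] := eqVneq x 0; first by rewrite linear0 !normr0 mulr0.
have nx : 0 < `|x| by rewrite normr_gt0.
rewrite -ler_pdivrMr//.
suff -> : `|f x| / `|x| = `|f (`|x|^-1 *: x)|.
  apply: sup_upper_bound => //; exists (`|x|^-1 *: x) => //=.
  by rewrite normrZ normfV normr_id mulVf// normr_eq0.
by rewrite linearZ/= normrM normfV normr_id mulrC.
Qed.

Let opnorm_le f k : 0 <= k -> (forall x, `|f x| <= k * `|x|) -> opnorm f <= k.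
Proof.
move=> k0 fk; apply: ge_sup; first by have [] := opnorm_has_sup f.
move=> _ [x /= x1 <-]; rewrite (le_trans (fk x))//.
by rewrite -[leRHS]mulr1 ler_wpM2l.
Qed.

Let ler_opnormD f g : opnorm (f + g) <= opnorm f + opnorm g.
Proof.
apply: opnorm_le => [|x]; first by rewrite addr_ge0.
by rewrite dualDE (le_trans (ler_normD _ _))// mulrDl lerD.
Qed.

Let opnormZ_le (a : R) f : opnorm (a *: f) <= `|a| * opnorm f.
Proof.
apply: opnorm_le => [|x]; first by rewrite mulr_ge0.
by rewrite dualZE normrM -mulrA ler_wpM2l.
Qed.

Let opnormZ (a : R) f : opnorm (a *: f) = `|a| * opnorm f.
Proof.
apply/eqP; rewrite eq_le opnormZ_le/=.
have [->|a0] := eqVneq a 0; first by rewrite normr0 mul0r.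
rewrite -ler_pdivlMl ?normr_gt0// -normfV.
by rewrite -[in leLHS](scalerK a0 f).
Qed.

Let opnorm0_eq0 f : opnorm f = 0 -> f = 0.
Proof.
move=> f0; apply: dualP => x; apply/eqP; rewrite -normr_le0.
by have := le_opnorm f x; rewrite f0 mul0r.
Qed.

HB.instance Definition _ := Lmodule_isNormed.Build R dual
  ler_opnormD opnormZ opnorm0_eq0.

Lemma dual_normE f : `|f| = sup [set `|f x| | x in [set x | `|x| <= 1]].
Proof. by []. Qed.

Lemma ler_dual_norm f x : `|f x| <= `|f| * `|x|.
Proof. exact: le_opnorm. Qed.

Lemma dual_norm_ler f k :
  0 <= k -> (forall x, `|f x| <= k * `|x|) -> `|f| <= k.
Proof. exact: opnorm_le. Qed.

Lemma is_dual_bounded (f : X -> R) (k : R) :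
  linear (f : X -> R^o) -> (forall x, `|f x| <= k * `|x|) -> f \in is_dual.
Proof.
move=> lf fk; apply/asboolP; split => //.
pose fL : {linear X -> R^o} :=
  HB.pack (f : X -> R^o) (GRing.isLinear.Build R X R^o _ f lf).
suff : continuous fL by [].
apply/linear_bounded_continuous/linear_boundedP.
exists k; split=> [|r /ltW kr x]; first exact: num_real.
by rewrite (le_trans (fk x))// ler_wpM2r.
Qed.

End dual.

Section lip0.
Context {R : realType} {M : metricType R} (o : M).

Definition is_lip0 : {pred M -> R} :=
  [pred f : M -> R | `[< f o = 0 /\
     exists k, forall x y, `|f x - f y| <= k * mdist x y >]].

Record Lip0 := MkLip0 { lip0_val :> M -> R ; lip0_valP : lip0_val \in is_lip0 }.

HB.instance Definition _ := [isSub for lip0_val].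
HB.instance Definition _ := [Choice of Lip0 by <:].

Let is_lip0_submod : submod_closed is_lip0.
Proof.
split.
  apply/asboolP; split => //; exists 0 => x y.
  by rewrite mul0r /GRing.zero/= subrr normr0.
move=> a f g /asboolP[f0 [k fk]] /asboolP[g0 [l gl]]; apply/asboolP; split.
  by change (a * f o + g o = 0); rewrite f0 g0 mulr0 addr0.
exists (`|a| * k + l) => x y.
change (`|(a * f x + g x) - (a * f y + g y)| <= (`|a| * k + l) * mdist x y).
have -> : (a * f x + g x) - (a * f y + g y) = a * (f x - f y) + (g x - g y).
  by ring.
rewrite (le_trans (ler_normD _ _))// normrM mulrDl lerD//.
by rewrite -mulrA ler_wpM2l.
Qed.

HB.instance Definition _ := GRing.isSubmodClosed.Build R (M -> R) is_lip0
  is_lip0_submod.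
HB.instance Definition _ := [SubChoice_isSubLmodule of Lip0 by <:].

Implicit Types (f g : Lip0) (x y : M).

Lemma lip0P f g : (forall x, f x = g x) -> f = g.
Proof. by move=> fg; apply/val_inj/funext. Qed.

Lemma lip0_base f : f o = 0.
Proof. by have /asboolP[] := lip0_valP f. Qed.

Lemma lip00E x : (0 : Lip0) x = 0. Proof. by []. Qed.
Lemma lip0DE f g x : (f + g) x = f x + g x. Proof. by []. Qed.
Lemma lip0NE f x : (- f) x = - f x. Proof. by []. Qed.
Lemma lip0ZE (a : R) f x : (a *: f) x = a * f x. Proof. by []. Qed.

Definition lipnorm f : R :=
  sup [set `|f p.1 - f p.2| / mdist p.1 p.2 | p in [set p | p.1 != p.2]].

Let lipnorm_ubound f : has_ubound
  [set `|f p.1 - f p.2| / mdist p.1 p.2 | p in [set p | p.1 != p.2]].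
Proof.
have /asboolP[_ [k fk]] := lip0_valP f.
exists k => _ [[x y]/= xy <-]; rewrite ler_pdivrMr; first exact: fk.
by rewrite mdist_gt0.
Qed.

Let lipnorm_ge0 f : 0 <= lipnorm f.
Proof.
rewrite /lipnorm; set A := (X in sup X).
have [->|/set0P[t At]] := eqVneq A set0; first by rewrite sup0.
apply: (@le_trans _ _ t); last by apply: ub_le_sup => //; exact: lipnorm_ubound.
by have [p _ <-] := At; rewrite divr_ge0// mdist_ge0.
Qed.

Let le_lipnorm f x y : `|f x - f y| <= lipnorm f * mdist x y.
Proof.
have [->|xy] := eqVneq x y; first by rewrite subrr normr0 mdistxx mulr0.
rewrite -ler_pdivrMr ?mdist_gt0//; apply: ub_le_sup => //.
by exists (x, y).
Qed.

Let lipnorm_le f k : 0 <= k ->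
  (forall x y, `|f x - f y| <= k * mdist x y) -> lipnorm f <= k.
Proof.
move=> k0 fk; rewrite /lipnorm; set A := (X in sup X).
have [->|/set0P[t At]] := eqVneq A set0; first by rewrite sup0.
apply: ge_sup; first by exists t.
by move=> _ [[x y]/= xy <-]; rewrite ler_pdivrMr ?mdist_gt0.
Qed.

Let ler_lipnormD f g : lipnorm (f + g) <= lipnorm f + lipnorm g.
Proof.
apply: lipnorm_le => [|x y]; first by rewrite addr_ge0.
by rewrite !lip0DE opprD addrACA (le_trans (ler_normD _ _))// mulrDl lerD.
Qed.

Let lipnormZ_le (a : R) f : lipnorm (a *: f) <= `|a| * lipnorm f.
Proof.
apply: lipnorm_le => [|x y]; first by rewrite mulr_ge0.
by rewrite !lip0ZE -mulrBr normrM -mulrA ler_wpM2l.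
Qed.

Let lipnormZ (a : R) f : lipnorm (a *: f) = `|a| * lipnorm f.
Proof.
apply/eqP; rewrite eq_le lipnormZ_le/=.
have [->|a0] := eqVneq a 0; first by rewrite normr0 mul0r.
rewrite -ler_pdivlMl ?normr_gt0// -normfV.
by rewrite -[in leLHS](scalerK a0 f).
Qed.

Let lipnorm0_eq0 f : lipnorm f = 0 -> f = 0.
Proof.
move=> f0; apply: lip0P => x; apply/eqP; rewrite -normr_le0.
by have := le_lipnorm f x o; rewrite f0 mul0r lip0_base subr0.
Qed.

HB.instance Definition _ := Lmodule_isNormed.Build R Lip0
  ler_lipnormD lipnormZ lipnorm0_eq0.

Lemma lip0_normE f : `|f| =
  sup [set `|f p.1 - f p.2| / mdist p.1 p.2 | p in [set p | p.1 != p.2]].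
Proof. by []. Qed.

Lemma ler_lip0_norm f x y : `|f x - f y| <= `|f| * mdist x y.
Proof. exact: le_lipnorm. Qed.

Lemma lip0_norm_ler f k : 0 <= k ->
  (forall x y, `|f x - f y| <= k * mdist x y) -> `|f| <= k.
Proof. exact: lipnorm_le. Qed.

Let delta_fun (m : M) (f : Lip0) : R := f m.

Let delta_fun_dual m : delta_fun m \in @is_dual R Lip0.
Proof.
apply: (@is_dual_bounded _ _ _ (mdist m o)) => // f.
rewrite /delta_fun mulrC.
by have := ler_lip0_norm f m o; rewrite lip0_base subr0.
Qed.

Definition delta (m : M) : dual Lip0 := Dual (delta_fun_dual m).

Lemma deltaE m f : delta m f = f m. Proof. by []. Qed.

End lip0.

Section lipschitz_free.
Context {R : realType} {M : metricType R} (o : M).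

Definition lspan {V : lmodType R} (A : set V) : set V :=
  [set v | exists (n : nat) (c : 'I_n -> R) (a : 'I_n -> V),
     (forall i, A (a i)) /\ v = \sum_i c i *: a i].

(* The closure is taken in the norm topology of the dual of Lip0 o. *)
Definition is_free : {pred dual (Lip0 o)} :=
  [pred mu | `[< closure (lspan (range (delta o))) mu >]].

Record Free := MkFree { free_val :> dual (Lip0 o) ;
                        free_valP : free_val \in is_free }.

HB.instance Definition _ := [isSub for free_val].
HB.instance Definition _ := [Choice of Free by <:].

Let is_freeP (mu : dual (Lip0 o)) : (mu \in is_free) <->
  forall e, 0 < e -> exists2 nu, lspan (range (delta o)) nu & `|mu - nu| < e.
Proof.
split=> [/asboolP cmu e e0|H].
  have [nu [? ?]] := cmu _ (nbhsx_ballx mu _ e0).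
  by exists nu => //; rewrite -ball_normE in H0 *.
apply/asboolP => B /nbhs_ballP[e /= e0 eB].
have [nu nuS nue] := H e e0; exists nu; split => //.
by apply: eB; rewrite -ball_normE.
Qed.

Let lspan_submod (V : lmodType R) (A : set V) a u v :
  lspan A u -> lspan A v -> lspan A (a *: u + v).
Proof.
move=> [n [c [x [Ax ->]]]] [p [d [y [Ay ->]]]].
exists (n + p)%N,
  (fun i => match fintype.split i with inl j => a * c j | inr j => d j end),
  (fun i => match fintype.split i with inl j => x j | inr j => y j end).
split; first by move=> i; case: fintype.split.
rewrite big_split_ord/= scaler_sumr; congr (_ + _); apply: eq_bigr => i _.
  by rewrite (unsplitK (inl _ i)) scalerA.
by rewrite (unsplitK (inr _ i)).
Qed.

Let is_free_submod : submod_closed is_free.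
Proof.
split.
  apply/is_freeP => e e0; exists 0; last by rewrite subrr normr0.
  exists 0%N, (fun=> 0), (fun=> 0).
  by split; [case|rewrite big_ord0].
move=> a u v /is_freeP Hu /is_freeP Hv; apply/is_freeP => e e0.
have a1 : 0 < `|a| + 1 by rewrite ltr_wpDl.
have e2 : 0 < e / 2 by rewrite divr_gt0.
have [u' Su' uu'] := Hu _ (divr_gt0 e2 a1).
have [v' Sv' vv'] := Hv _ e2.
exists (a *: u' + v'); first exact: lspan_submod.
rewrite opprD addrACA -scalerBr (le_lt_trans (ler_normD _ _))// normrZ.
rewrite [ltRHS]splitr ler_ltD//.
rewrite (@le_trans _ _ ((`|a| + 1) * `|u - u'|))//.
  by rewrite ler_wpM2r// lerDl.
by rewrite -ler_pdivlMl// mulrC ltW.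
Qed.

HB.instance Definition _ := GRing.isSubmodClosed.Build R (dual (Lip0 o)) is_free
  is_free_submod.
HB.instance Definition _ := [SubChoice_isSubLmodule of Free by <:].

Implicit Types mu nu : Free.

Let freenorm mu : R := `|free_val mu|.

Let ler_freenormD mu nu : freenorm (mu + nu) <= freenorm mu + freenorm nu.
Proof. exact: ler_normD. Qed.

Let freenormZ (a : R) mu : freenorm (a *: mu) = `|a| * freenorm mu.
Proof. exact: normrZ. Qed.

Let freenorm0_eq0 mu : freenorm mu = 0 -> mu = 0.
Proof. by move=> /normr0_eq0 mu0; apply: val_inj. Qed.

HB.instance Definition _ := Lmodule_isNormed.Build R Free
  ler_freenormD freenormZ freenorm0_eq0.

Lemma free_normE mu : `|mu| = `|free_val mu|. Proof. by []. Qed.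
Lemma free0E (f : Lip0 o) : (0 : Free) f = 0. Proof. by []. Qed.
Lemma freeDE mu nu (f : Lip0 o) : (mu + nu) f = mu f + nu f. Proof. by []. Qed.
Lemma freeNE mu (f : Lip0 o) : (- mu) f = - mu f. Proof. by []. Qed.
Lemma freeZE (a : R) mu (f : Lip0 o) : (a *: mu) f = a * mu f.
Proof. by []. Qed.

Let delta_free m : delta o m \in is_free.
Proof.
apply/is_freeP => e e0; exists (delta o m); last by rewrite subrr normr0.
exists 1%N, (fun=> 1), (fun=> delta o m); split; first by move=> _; exists m.
by rewrite big_ord1 scale1r.
Qed.

Definition fdelta (m : M) : Free := MkFree (delta_free m).

Lemma fdeltaE m (f : Lip0 o) : fdelta m f = f m. Proof. by []. Qed.

Lemma free_dense mu (e : R) : 0 < e ->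
  exists n (c : 'I_n -> R) (m : 'I_n -> M),
    `|mu - \sum_i c i *: fdelta (m i)| < e.
Proof.
move=> e0; have /is_freeP/(_ _ e0)[_ [n [c [a [Aa ->]]]] muce] := free_valP mu.
have /boolp.choice[m am] : forall i, exists x, delta o x = a i.
  by move=> i; have [x _ <-] := Aa i; exists x.
exists n, c, m; rewrite free_normE; apply: le_lt_trans muce.
suff -> : free_val (mu - \sum_i c i *: fdelta (m i)) =
  free_val mu - \sum_i c i *: a i by [].
rewrite -[LHS]/(free_val mu - \val (\sum_i c i *: fdelta (m i))) raddf_sum/=.
congr (_ - _); apply: eq_bigr => i _.
by rewrite -am.
Qed.

Let lip_eval_fun (f : Lip0 o) (mu : Free) : R := mu f.

Let lip_eval_is_dual f : lip_eval_fun f \in @is_dual R Free.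
Proof.
apply: (@is_dual_bounded _ _ _ `|f|) => // mu.
by rewrite mulrC; exact: (ler_dual_norm (free_val mu) f).
Qed.

Definition lip_eval (f : Lip0 o) : dual Free := Dual (lip_eval_is_dual f).

Lemma lip_evalE f mu : lip_eval f mu = mu f. Proof. by []. Qed.

Lemma lip_eval_linear : linear lip_eval.
Proof. by move=> a f g; apply: dualP => mu; exact: linearP. Qed.

HB.instance Definition _ := GRing.isLinear.Build R (Lip0 o) (dual Free) _
  lip_eval lip_eval_linear.

Lemma fdelta_norm_le x y : `|fdelta x - fdelta y| <= mdist x y.
Proof.
rewrite free_normE; apply: dual_norm_ler => [|f]; first exact: mdist_ge0.
rewrite mulrC; exact: ler_lip0_norm.
Qed.

Lemma lip_eval_isometry f : `|lip_eval f| = `|f|.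
Proof.
apply/eqP; rewrite eq_le; apply/andP; split.
  apply: dual_norm_ler => // mu.
  by rewrite mulrC; exact: (ler_dual_norm (free_val mu) f).
apply: lip0_norm_ler => // x y.
have -> : f x - f y = lip_eval f (fdelta x - fdelta y) by [].
by rewrite (le_trans (ler_dual_norm _ _))// ler_wpM2l// fdelta_norm_le.
Qed.

Lemma lip_eval_surj (phi : dual Free) : exists f, lip_eval f = phi.
Proof.
pose f m := phi (fdelta m).
have f0 : f o = 0.
  suff -> : f o = phi 0 by rewrite linear0.
  congr (phi _); apply: val_inj; apply: dualP => g; exact: lip0_base.
have flip : f \in is_lip0 o.
  apply/asboolP; split=> //; exists `|phi| => x y.
  rewrite /f -[X in `|X|]/(phi (fdelta x) - phi (fdelta y)) -linearB.
  by rewrite (le_trans (ler_dual_norm _ _))// ler_wpM2l// fdelta_norm_le.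
exists (MkLip0 flip); set F := MkLip0 _; apply: dualP => mu.
apply/eqP; rewrite -subr_eq0 -normr_le0; apply/ler_addgt0Pl => e e0.
rewrite addr0.
pose psi := lip_eval F - phi.
have p1 : 0 < `|psi| + 1 by rewrite ltr_wpDl.
have [n [c [m mue]]] := free_dense mu (divr_gt0 e0 p1).
have psi0 : psi (\sum_i c i *: fdelta (m i)) = 0.
  rewrite linear_sum big1// => i _.
  transitivity (c i * psi (fdelta (m i))); first exact: linearZ.
  have -> : psi (fdelta (m i)) = 0 by exact: subrr.
  exact: mulr0.
have -> : lip_eval F mu - phi mu = psi (mu - \sum_i c i *: fdelta (m i)).
  transitivity (psi mu - psi (\sum_i c i *: fdelta (m i))).
    by rewrite psi0 subr0.
  exact/esym/linearB.
rewrite (le_trans (ler_dual_norm _ _))//.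
rewrite (@le_trans _ _ ((`|psi| + 1) * (e / (`|psi| + 1))))//.
  by rewrite ler_pM ?lerDl// ltW.
by rewrite mulrC divfK// gt_eqF.
Qed.

End lipschitz_free.

Section weak_star.
Context {R : realType} {X Z : normedModType R}.

(* Z as a realization of the dual of X: a linear isometric bijection of Z onto
   the space of bounded functionals on X. Weak-star slices of the unit ball of Z
   are taken with respect to the predual X through this identification. *)
Record isometric_dual := IsometricDual {
  dual_map :> {linear Z -> dual X} ;
  dual_map_isometry : forall z, `|dual_map z| = `|z| ;
  dual_map_surj : forall phi, exists z, dual_map z = phi }.

Variable J : isometric_dual.

Definition wstar_slice (S : set Z) : Prop :=
  exists (x : X) (alpha : R), [/\ `|x| = 1, 0 < alpha &
    S = [set z | `|z| <= 1 /\ 1 - alpha < J z x]].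

(* The pointwise combination w_0 S_0 + ... + w_(n-1) S_(n-1). *)
Definition set_comb (n : nat) (w : 'I_n -> R) (S : 'I_n -> set Z) : set Z :=
  [set \sum_i w i *: f i | f in [set f : 'I_n -> Z | forall i, S i (f i)]].

(* Extended-real supremum, so that no boundedness convention is involved. *)
Definition diam (A : set Z) : \bar R :=
  ereal_sup [set `|f - g|%:E | f in A & g in A].

Definition wstar_SD2P : Prop :=
  forall (n : nat) (w : 'I_n -> R) (S : 'I_n -> set Z),
    (forall i, wstar_slice (S i)) ->
    (forall i, 0 <= w i) -> \sum_i w i = 1 ->
    diam (set_comb w S) = 2%:E.

(* Families are nonempty: they are indexed by 'I_n.+1. *)
Definition wstar_SSD2P : Prop :=
  forall (n : nat) (S : 'I_n.+1 -> set Z) (e : R),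
    (forall i, wstar_slice (S i)) -> 0 < e ->
    exists (f : 'I_n.+1 -> Z) (g : Z),
      [/\ forall i, S i (f i), `|g| <= 1,
          forall i, S i (f i + g) /\ S i (f i - g) & 1 - e < `|g|].

End weak_star.

(* The identification of Lip0 o with the dual of the Lipschitz-free space,
   determined by <f, fdelta m> = f m. *)
Definition lip0_dual {R : realType} {M : metricType R} (o : M) :
  @isometric_dual R (Free o) (Lip0 o) :=
  @IsometricDual R (Free o) (Lip0 o) (@lip_eval R M o)
    (@lip_eval_isometry R M o) (@lip_eval_surj R M o).

(* pa i, pb i, pu k, pv k stand for a_i, b_i, u_k, v_k, with bool in place of
   {1, 2}. *)
Variant point := pa of bool | pb of bool | pu of nat | pv of nat.

Definition point_sum (p : point) : (bool + bool) + (nat + nat) :=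
  match p with
  | pa i => inl (inl i) | pb i => inl (inr i)
  | pu k => inr (inl k) | pv k => inr (inr k)
  end.

Definition sum_point (s : (bool + bool) + (nat + nat)) : point :=
  match s with
  | inl (inl i) => pa i | inl (inr i) => pb i
  | inr (inl k) => pu k | inr (inr k) => pv k
  end.

Lemma point_sumK : cancel point_sum sum_point. Proof. by case. Qed.

HB.instance Definition _ := Choice.copy point (can_type point_sumK).

(* The pairs at distance 1. *)
Definition unit_pair (p q : point) : bool :=
  match p, q with
  | pa _, pb _ | pb _, pa _ => true
  | pa _, pu _ | pu _, pa _ => true
  | pb _, pv _ | pv _, pb _ => true
  | pu k, pv l | pv k, pu l => k == l
  | _, _ => false
  end.

(* The metric, hence the uniform structure, depends on R, so the carrier is an
   alias that records R. *)
Definition trap_space (R : realType) : Type := point.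

Section trap_metric.
Variable R : realType.

HB.instance Definition _ := Choice.copy (trap_space R) point.

Definition trap_dist (p q : trap_space R) : R :=
  if p == q then 0 else if unit_pair p q then 1 else 2.

Let trap_distxx p : trap_dist p p = 0.
Proof. by rewrite /trap_dist eqxx. Qed.

Let trap_dist_eq0 p q : trap_dist p q = 0 -> p = q.
Proof.
rewrite /trap_dist; case: eqVneq => // _.
by case: ifP => _ /eqP; rewrite ?oner_eq0 ?pnatr_eq0.
Qed.

Let unit_pairC p q : unit_pair p q = unit_pair q p.
Proof. by case: p q => ? [] ? //=; rewrite eq_sym. Qed.

Let trap_distC p q : trap_dist p q = trap_dist q p.
Proof. by rewrite /trap_dist eq_sym unit_pairC. Qed.

Let trap_dist_triangle q p r :
  trap_dist p r <= trap_dist p q + trap_dist q r.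
Proof.
rewrite /trap_dist.
have [->|pq] := eqVneq p q; first by rewrite add0r.
have [<-|qr] := eqVneq q r; first by rewrite (negbTE pq) addr0.
by do !case: ifP => _; lra.
Qed.

HB.instance Definition _ := isMetric.Build R (trap_space R)
  trap_distxx trap_dist_eq0 trap_distC trap_dist_triangle.

Lemma trap_mdistE (p q : trap_space R) : mdist p q = trap_dist p q.
Proof. by []. Qed.

End trap_metric.

(* Main.v *)
Require Import Defs.
From mathcomp Require Import all_boot all_order all_algebra.
From mathcomp Require Import all_classical all_reals all_analysis.
From mathcomp Require Import lra.

Set Implicit Arguments.
Unset Strict Implicit.
Unset Printing Implicit Defensive.

Import Order.TTheory GRing.Theory Num.Theory.
Import numFieldNormedType.Exports.

Local Open Scope classical_set_scope.
Local Open Scope ring_scope.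

(** Both diameter properties of the dual are controlled by trapezoids in M.

    A weak-star slice depends, up to a small error, on the values of its members
    on a finite set N (slice_finitely_determined). For a pair (u, v) given by
    the long trapezoid property for N, a multiple by a factor close to 1 of any
    1-Lipschitz function on N extends to a 1-Lipschitz function with slope
    nearly 1 along (u, v), and to another one with slope nearly -1
    (trapezoid_extension). Doing this simultaneously for finitely many slices
    gives two points of their convex combination at distance nearly 2
    (long_trapezoid_wstar_SD2P).

    Conversely, the slices given by the molecules of a finite set N, that is,
    those of functions with slope nearly 1 on a prescribed pair of N, admit a
    common symmetric perturbation g of norm nearly 1. A pair (u, v) on which g
    has slope nearly 1 witnesses the strong long trapezoid property for N
    (wstar_SSD2P_strong_long_trapezoid).

    In the space of trapezoids, a pair (u_k, v_k) of fresh points is a long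
    trapezoid for any finite set. However, every point is at distance 1 from
    both a_1, a_2 or from both b_1, b_2, and for these four points no pair
    (u, v) satisfies the second inequality
    (trap_space_not_strong_long_trapezoid). *)

(** * Lipschitz functions and molecules *)

Section lipschitz_functions.
Context {R : realType} {M : metricType R} (o : M).

Lemma lip0_norm1P (f : Lip0 o) :
  `|f| <= 1 <-> forall x y, f x - f y <= mdist x y.
Proof.
split=> [f1 x y|f1].
  rewrite (le_trans (ler_norm _))// (le_trans (ler_lip0_norm f x y))//.
  by rewrite -[leRHS]mul1r ler_wpM2r// mdist_ge0.
apply: lip0_norm_ler => // x y; rewrite mul1r ler_norml f1 andbT.
by rewrite lerNl opprB metric_sym f1.
Qed.

Lemma lip0_norm1_ex (f : M -> R) : f o = 0 ->
    (forall x y, f x - f y <= mdist x y) ->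
  exists2 F : Lip0 o, `|F| <= 1 & forall x, F x = f x.
Proof.
move=> fo f1.
have fL : f \in is_lip0 o.
  apply/asboolP; split=> //; exists 1 => x y; rewrite mul1r ler_norml f1 andbT.
  by rewrite lerNl opprB metric_sym f1.
by exists (MkLip0 fL) => //; apply/lip0_norm1P.
Qed.

Lemma fdelta_dist x y : `|fdelta o x - fdelta o y| = mdist x y.
Proof.
apply/eqP; rewrite eq_le fdelta_norm_le/=.
have [||F F1 Fx] := @lip0_norm1_ex (fun z => mdist z y - mdist o y).
- exact: subrr.
- by move=> z t; rewrite opprB addrA subrK lerBlDr metric_triangle.
have Fxy : (fdelta o x - fdelta o y) F = mdist x y.
  have -> : (fdelta o x - fdelta o y) F = F x - F y by [].
  by rewrite !Fx mdistxx; lra.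
rewrite -[leLHS]ger0_norm ?mdist_ge0// -{1}Fxy free_normE.
rewrite (le_trans (ler_dual_norm _ _))//.
by rewrite -[leRHS]mulr1 ler_wpM2l.
Qed.

Lemma molecule_slice (x y : M) (alpha : R) : x != y -> 0 < alpha ->
  wstar_slice (lip0_dual o)
    [set f : Lip0 o | `|f| <= 1 /\ (1 - alpha) * mdist x y < f x - f y].
Proof.
move=> xy a0; have d0 : 0 < mdist x y by rewrite mdist_gt0.
exists ((mdist x y)^-1 *: (fdelta o x - fdelta o y)), alpha; split => //.
  by rewrite normrZ fdelta_dist normfV gtr0_norm// mulVf// gt_eqF.
have JE (f : Lip0 o) :
    (lip0_dual o) f ((mdist x y)^-1 *: (fdelta o x - fdelta o y)) =
    (f x - f y) / mdist x y by rewrite mulrC.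
by apply/seteqP; split => f []; rewrite /mkset JE ltr_pdivlMr.
Qed.

(** The linear combinations of point evaluations are dense in the predual and
    see only finitely many points, so the values on a finite set nearly decide
    membership in a slice. Slices being relatively open, the factor 1 - e keeps
    f in the slice while making it (1 - e)-Lipschitz, which leaves room to
    prescribe slopes elsewhere. *)
Lemma slice_finitely_determined (S : set (Lip0 o)) :
    wstar_slice (lip0_dual o) S ->
  exists (N : set M) (f : Lip0 o), [/\ finite_set N, `|f| <= 1 &
    \forall e \near 0^'+, forall F : Lip0 o, `|F| <= 1 ->
      (forall x, N x -> F x = (1 - e) * f x) -> S F].
Proof.
move=> [mu [alpha [mu1 a0 ->]]].
have mule (g : Lip0 o) : `|mu g| <= `|g|.
  by have := ler_dual_norm (free_val mu) g; rewrite -free_normE mu1 mul1r.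
have [f f1 fmu] : exists2 f : Lip0 o, `|f| <= 1 & 1 - alpha < mu f.
  have : 1 - alpha < sup [set `|mu f| | f in [set f : Lip0 o | `|f| <= 1]].
    by rewrite -dual_normE -free_normE mu1; lra.
  move=> /sup_gt[|_ [f /= f1 <-]].
    by exists `|mu 0|, 0 => //=; rewrite normr0 ler01.
  have [m0|m0] := leP 0 (mu f); first by rewrite ger0_norm//; exists f.
  rewrite ltr0_norm// => af; exists (- f); first by rewrite normrN.
  by rewrite linearN.
pose g := mu f - (1 - alpha).
have g0 : 0 < g by rewrite /g subr_gt0.
have [n [c [m mum]]] := free_dense mu (divr_gt0 g0 (ltr0n R 4)).
set nu := \sum_i _ in mum.
have nuE (F : Lip0 o) : nu F = \sum_i c i * F (m i).
  rewrite -[LHS]/(lip_eval F nu) /nu.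
  transitivity (\sum_(i < n) lip_eval F (c i *: fdelta o (m i))).
    exact: linear_sum.
  by apply: eq_bigr.
have munu (F : Lip0 o) : `|F| <= 1 -> `|mu F - nu F| <= g / 4.
  move=> F1; have -> : mu F - nu F = (mu - nu) F by [].
  rewrite (le_trans (ler_dual_norm _ _))// -free_normE.
  by rewrite -[leRHS]mulr1 ler_pM// ltW.
exists (range m), f; split=> //; first exact: finite_image.
have g4 : 0 < Num.min 1 (g / 4) by rewrite lt_min ltr01 divr_gt0.
near=> e => F F1 Fm; split=> //.
have e0 : 0 < e by near: e; exact: nbhs_right_gt.
have : e < Num.min 1 (g / 4) by near: e; exact: nbhs_right_lt.
rewrite lt_min => /andP[e1 eg].
have nuF : nu F = (1 - e) * nu f.
  rewrite !nuE mulr_sumr; apply: eq_bigr => i _.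
  by rewrite Fm; [rewrite mulrCA|exists i].
rewrite -[X in _ < X]/(mu F).
have := munu _ F1; have := munu _ f1; have := mule f.
rewrite nuF !ler_norml => /andP[_ h1] /andP[_ h2] /andP[h3 _].
have : mu f <= 1 by rewrite (le_trans h1).
rewrite /g in g0 eg h2 h3 *; nra.
Unshelve. all: by end_near. Qed.

End lipschitz_functions.

(** * The long trapezoid property and convex combinations of slices *)

Section long_trapezoid_sd2.
Context {R : realType} {M : metricType R}.

(** With E and G the largest and the smallest 1-Lipschitz extensions of f from N,
    the trapezoid inequality and the bound on the slopes of f give
    E u - G v >= (1 - e) d(u, v). Taking the value G v at v and then the largest
    1-Lipschitz extension gives F = min (E, G v + d(., v)). *)
Lemma trapezoid_extension (N : set M) (e : R) (u v o : M) (f : M -> R) :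
    0 <= e -> N o -> trapezoid_ineq N e u v ->
    (forall x y, N x -> N y -> f x - f y <= (1 - e) * mdist x y) ->
  exists F : M -> R, [/\ forall x y, F x - F y <= mdist x y,
    forall x, N x -> F x = f x & (1 - e) * mdist u v <= F u - F v].
Proof.
move=> e0 No Nuv fL.
have fL1 x y : N x -> N y -> f x - f y <= mdist x y.
  move=> Nx Ny; rewrite (le_trans (fL x y Nx Ny))//.
  by rewrite -[leRHS]mul1r ler_wpM2r ?mdist_ge0// lerBlDr lerDl.
pose A m := [set f x + mdist x m | x in N].
pose B m := [set f x - mdist x m | x in N].
pose E m := inf (A m).
pose G m := sup (B m).
have A0 m : A m !=set0 by exists (f o + mdist o m), o.
have B0 m : B m !=set0 by exists (f o - mdist o m), o.
have BA m m' x y : N x -> N y ->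
    f y - mdist y m' <= f x + mdist x m + mdist m m'.
  move=> Nx Ny; have := fL1 y x Ny Nx.
  have := metric_triangle y m' x; have := metric_triangle m' m x.
  by rewrite (metric_sym m' m) (metric_sym m x); lra.
have lbA m : has_lbound (A m).
  by exists (f o - mdist o m) => _ [x Nx <-];
     have := BA m m x o Nx No; rewrite mdistxx addr0.
have ubB m : has_ubound (B m).
  by exists (f o + mdist o m) => _ [x Nx <-];
     have := BA m m o x No Nx; rewrite mdistxx addr0.
have Ele m x : N x -> E m <= f x + mdist x m.
  by move=> Nx; apply: ge_inf => //; exists x.
have Gge m x : N x -> f x - mdist x m <= G m.
  by move=> Nx; apply: ub_le_sup => //; exists x.
have GE k m m' : (forall x y, N x -> N y ->
    f y - mdist y m' + k <= f x + mdist x m) -> G m' + k <= E m.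
  move=> H; apply: lb_le_inf => // _ [x Nx <-].
  rewrite -lerBrDr; apply: ge_sup => // _ [y Ny <-].
  by rewrite lerBrDr H.
have EL m m' : E m - E m' <= mdist m m'.
  rewrite lerBlDr -lerBlDl; apply: lb_le_inf => // _ [x Nx <-].
  have := Ele m x Nx; have := metric_triangle x m' m.
  by rewrite (metric_sym m' m); lra.
pose F m := Num.min (E m) (G v + mdist m v).
have GvEv : G v <= E v.
  rewrite -[leLHS]addr0; apply: GE => x y Nx Ny.
  by have := BA v v x y Nx Ny; rewrite mdistxx !addr0.
have Fv : F v = G v by rewrite /F mdistxx addr0 min_r.
exists F; split.
- move=> m m'; rewrite /F lerBlDr addr_minr le_min !ge_min.
  apply/andP; split; apply/orP; [left|right].
    by have := EL m m'; lra.
  by have := metric_triangle m m' v; lra.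
- move=> x Nx; rewrite /F; have -> : E x = f x.
    apply/eqP; rewrite eq_le; apply/andP; split.
      by have := Ele x x Nx; rewrite mdistxx addr0.
    apply: lb_le_inf => // _ [y Ny <-].
    by have := fL1 x y Nx Ny; rewrite metric_sym; lra.
  by rewrite min_l//; have := Gge v x Nx; lra.
- rewrite Fv lerBrDl le_min; apply/andP; split.
    apply: GE => x y Nx Ny.
    have := Nuv x y Nx Ny; have := fL y x Ny Nx.
    by rewrite (metric_sym y x); lra.
  rewrite lerD2l -[leRHS]mul1r ler_wpM2r ?mdist_ge0//.
  by rewrite lerBlDr lerDl.
Qed.

Lemma trapezoid_ineqC (N : set M) (e : R) (u v : M) :
  trapezoid_ineq N e u v -> trapezoid_ineq N e v u.
Proof.
move=> H x y Nx Ny; rewrite [leRHS]addrC (metric_sym x y) (metric_sym v u).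
exact: H.
Qed.

Lemma set_comb_norm_le1 (o : M) n (w : 'I_n -> R) (S : 'I_n -> set (Lip0 o)) z :
    (forall i, wstar_slice (lip0_dual o) (S i)) ->
    (forall i, 0 <= w i) -> \sum_i w i = 1 ->
  set_comb w S z -> `|z| <= 1.
Proof.
move=> sS w0 w1 [f Sf <-]; rewrite -w1 (le_trans (ler_norm_sum _ _ _))//.
apply: ler_sum => i _; rewrite normrZ ger0_norm// -[leRHS]mulr1 ler_wpM2l//.
by have [mu [a [_ _ SE]]] := sS i; have := Sf i; rewrite SE => -[].
Qed.

(** All the slices see a common finite set N, and the trapezoid inequality for N
    puts into every slice a function with slope nearly 1 on (u, v) and one
    with slope nearly 1 on (v, u). The pair does not depend on the slice, so the
    slopes survive in the convex combinations. *)
Lemma long_trapezoid_wstar_SD2P (o : M) :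
  long_trapezoid M -> wstar_SD2P (lip0_dual o).
Proof.
move=> ltM n w S sS w0 w1.
apply/eqP; rewrite eq_le; apply/andP; split.
  apply: ge_ereal_sup => _ [f Sf [g Sg <-]].
  rewrite lee_fin (le_trans (ler_normB _ _))//.
  have := set_comb_norm_le1 sS w0 w1 Sf.
  by have := set_comb_norm_le1 sS w0 w1 Sg; lra.
have /boolp.choice[N /boolp.choice[h H]] :=
  fun i => slice_finitely_determined (sS i).
apply/lee_addgt0Pr => t t0.
have /filter_forall Hnear : forall i, \forall e \near 0^'+,
    forall F : Lip0 o, `|F| <= 1 ->
      (forall x, N i x -> F x = (1 - e) * h i x) -> S i F.
  by move=> i; have [] := H i.
have m0 : 0 < Num.min 1 (t / 2) by rewrite lt_min ltr01 divr_gt0.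
have [e [e0 et He]] : exists e : R, [/\ 0 < e, e < Num.min 1 (t / 2) &
    forall i (F : Lip0 o), `|F| <= 1 ->
      (forall x, N i x -> F x = (1 - e) * h i x) -> S i F].
  near (0 : R)^'+ => e; exists e; split.
  - by near: e; exact: nbhs_right_gt.
  - by near: e; exact: nbhs_right_lt.
  - by near: e.
move: et; rewrite lt_min => /andP[e1 et].
pose N' := o |` \bigcup_(i in [set: 'I_n]) N i.
have finN' : finite_set N'.
  rewrite finite_setU; split; first exact: finite_set1.
  by apply: bigcup_finite => // i _; have [] := H i.
have [u [v [/eqP uv Nuv]]] := ltM N' e finN' e0.
have ext a b : trapezoid_ineq N' e a b -> exists F : 'I_n -> Lip0 o,
    forall i, S i (F i) /\ (1 - e) * mdist a b <= F i a - F i b.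
  move=> Nab; suff /boolp.choice[F HF] : forall i, exists F : Lip0 o,
    S i F /\ (1 - e) * mdist a b <= F a - F b by exists F.
  move=> i; have [_ h1 _] := H i.
  have [||x y _ _|F [F1 Fh Fab]] :=
      @trapezoid_extension N' e a b o (fun x => (1 - e) * h i x) _ _ Nab.
  - exact: ltW.
  - by left.
  - rewrite -mulrBr ler_wpM2l//; first by rewrite subr_ge0 ltW.
    exact: (lip0_norm1P (h i)).1.
  have [||G G1 GF] := @lip0_norm1_ex _ _ o F => //.
    by rewrite Fh; [rewrite lip0_base mulr0|left].
  exists G; split; last by rewrite !GF.
  by apply: He => // x Nx; rewrite GF Fh//; right; exists i.
have [f Hf] := ext _ _ Nuv.
have [g Hg] := ext _ _ (trapezoid_ineqC Nuv).
pose sf := \sum_i w i *: f i; pose sg := \sum_i w i *: g i.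
have sumE (F : 'I_n -> Lip0 o) x : (\sum_i w i *: F i) x = \sum_i w i * F i x.
  rewrite -[LHS]/(delta o x (\sum_i w i *: F i)).
  by rewrite linear_sum; apply: eq_bigr.
have d0 : 0 < mdist u v by rewrite mdist_gt0.
have slope (F : 'I_n -> Lip0 o) a b :
    (forall i, S i (F i) /\ (1 - e) * mdist a b <= F i a - F i b) ->
    (1 - e) * mdist a b <=
      (\sum_i w i *: F i) a - (\sum_i w i *: F i) b.
  move=> HF; rewrite !sumE -sumrB -[leLHS]mul1r -{1}w1 mulr_suml.
  by apply: ler_sum => i _; rewrite -mulrBr ler_wpM2l//; have [] := HF i.
have Hn : 2 - t <= `|sf - sg|.
  have : 2 * (1 - e) <= `|sf - sg|.
    rewrite -(ler_pM2r d0) (le_trans _ (ler_lip0_norm _ _ _))//.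
    rewrite (le_trans _ (ler_norm _))//.
    have -> : (sf - sg) u - (sf - sg) v = (sf u - sf v) + (sg v - sg u).
      by rewrite !lip0DE !lip0NE; lra.
    have := slope _ _ _ Hf; have := slope _ _ _ Hg;
       rewrite (metric_sym v u) -/sf -/sg; lra.
  by lra.
rewrite -leeBlDr//.
apply: (@le_trans _ _ `|sf - sg|%:E); first by rewrite lee_fin.
apply: ereal_sup_ubound; exists sf; last exists sg => //.
  by exists f => // i; have [] := Hf i.
by exists g => // i; have [] := Hg i.
Unshelve. all: by end_near. Qed.

End long_trapezoid_sd2.

(** * The symmetric strong diameter 2 property forces strong trapezoids *)

Section symmetric_sd2.
Context {R : realType} {M : metricType R} (o : M).

(** The symmetric property is applied to the slices of the molecules of N. The
    slice of the molecule of (p, q) is added to them: it provides f when x = y,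
    and makes the family nonempty. *)
Lemma wstar_SSD2P_perturbation (N : set M) (p q : M) (alpha : R) :
    wstar_SSD2P (lip0_dual o) -> finite_set N -> p != q -> 0 < alpha ->
  exists2 g : Lip0 o, 1 - alpha < `|g| &
    forall x y, N x -> N y -> exists f : Lip0 o,
      [/\ `|f + g| <= 1, `|f - g| <= 1,
        (1 - alpha) * mdist x y <= (f + g) x - (f + g) y &
        (1 - alpha) * mdist x y <= (f - g) x - (f - g) y].
Proof.
move=> ssd /finite_seqP[s ->] pq a0.
pose P := [seq z <- [seq (x, y) | x <- s, y <- s] | z.1 != z.2].
(* The pair (p, q) enters as the default value, at index size P. *)
pose z i := nth (p, q) P i.
have zneq i : (z i).1 != (z i).2.
  have [iP|Pi] := ltnP i (size P); last by rewrite /z nth_default.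
  by have := mem_nth (p, q) iP; rewrite mem_filter => /andP[].
have [f [g [_ _ fg ga]]] := ssd (size P)
  (fun i => [set f : Lip0 o | `|f| <= 1 /\
     (1 - alpha) * mdist (z i).1 (z i).2 < f (z i).1 - f (z i).2]) alpha
  (fun i => molecule_slice o (zneq i) a0) a0.
exists g => // x y xs ys.
have [->|xy] := eqVneq x y.
  exists (f ord0); have [[? _] [? _]] := fg ord0.
  by rewrite mdistxx mulr0 !subrr.
have xyP : (x, y) \in P.
  by rewrite mem_filter /= xy; apply/allpairsP; exists (x, y).
have iP : (index (x, y) P < (size P).+1)%N by rewrite ltnS index_size.
have := fg (Ordinal iP); rewrite /z /= nth_index//= => -[[? /ltW ?] [? /ltW ?]].
by exists (f (Ordinal iP)).
Qed.

(** Let g be a common perturbation with slope nearly 1 on (u, v). Since f + g and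
    f - g are 1-Lipschitz and both have slope nearly 1 on (x, y), the increments
    of g between points of N are small, and since g has slope nearly 1 on
    (u, v), so is the increment of f from v to u. Both inequalities follow by
    adding the 1-Lipschitz estimates for f + g and f - g along the edges of the
    right-hand side. *)
Lemma wstar_SSD2P_strong_long_trapezoid (p q : M) : p != q ->
  wstar_SSD2P (lip0_dual o) -> strong_long_trapezoid M.
Proof.
move=> pq ssd N e finN e0.
pose a := Num.min (2^-1) (e / 3).
have a0 : 0 < a by rewrite lt_min invr_gt0 ltr0n divr_gt0.
have a2 : a <= 2^-1 by rewrite ge_min lexx.
have ae : a <= e / 3 by rewrite ge_min lexx orbT.
have [g ga H] := wstar_SSD2P_perturbation ssd finN pq a0.
have [u [v [uv guv]]] :
    exists u v : M, u != v /\ (1 - a) * mdist u v <= g u - g v.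
  have [|_ [[u v] /= uv <-] guv] := sup_gt _ ga.
    by exists (`|g p - g q| / mdist p q), (p, q).
  have d0 : 0 < mdist u v by rewrite mdist_gt0.
  move: guv; rewrite ltr_pdivlMr// => guv.
  have [gp|gp] := leP 0 (g u - g v).
    by exists u, v; split=> //; rewrite -[leRHS](ger0_norm gp) ltW.
  exists v, u; rewrite eq_sym; split=> //.
  by rewrite (metric_sym v u) -[leRHS]opprB -(ltr0_norm gp) ltW.
have d0 := mdist_ge0 u v.
have gN x y : N x -> N y -> g x - g y <= a * mdist x y.
  move=> Nx Ny; have [f [/lip0_norm1P f1 _ _ f2]] := H x y Nx Ny.
  have ad0 : 0 <= a * mdist x y by rewrite mulr_ge0 ?mdist_ge0 ?ltW.
  have := f1 x y; move: f2; rewrite !lip0DE !lip0NE; lra.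
exists u, v; split=> [|x y Nx Ny|x y z w Nx Ny Nz Nw]; first exact/eqP.
- have [f [/lip0_norm1P fp /lip0_norm1P fm _ fxy]] := H x y Nx Ny.
  have := fp u v; have := fm x u; have := fm v y; move: fxy.
  rewrite !lip0DE !lip0NE (metric_sym v y) => h1 h2 h3 h4.
  have adxy : 0 <= a * mdist x y by rewrite mulr_ge0 ?mdist_ge0 ?ltW.
  have : (1 - 2 * a) * (mdist x y + mdist u v) <= mdist x u + mdist y v by lra.
  by apply: le_trans; rewrite ler_wpM2r ?addr_ge0 ?mdist_ge0//; lra.
- have [f [/lip0_norm1P fp /lip0_norm1P fm fxy fxy']] := H x y Nx Ny.
  have [h [/lip0_norm1P hp /lip0_norm1P hm hzw hzw']] := H z w Nz Nw.
  have gxz := gN x z Nx Nz; have gyw := gN y w Ny Nw.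
  (* The error terms are of size d(x, z) + d(y, w), which the paths x, u, v, z
     and y, u, v, w bound by the two sides of the inequality. *)
  have txz : mdist x z <= mdist x u + mdist u v + mdist z v.
    rewrite (metric_sym z v) (le_trans (metric_triangle x u z))// -addrA lerD2l.
    exact: metric_triangle.
  have tyw : mdist y w <= mdist y u + mdist u v + mdist w v.
    rewrite (metric_sym w v) (le_trans (metric_triangle y u w))// -addrA lerD2l.
    exact: metric_triangle.
  have := fm x u; have := fp u y; have := hp z v; have := hm v w.
  move: fxy fxy' hzw hzw'.
  rewrite !lip0DE !lip0NE (metric_sym u y) (metric_sym v w).
  set L := _ + mdist z w; set Q := _ + mdist w v => f1 f2 h1 h2 k1 k2 k3 k4.
  have L0 : 0 <= L by rewrite /L !addr_ge0 ?mulr_ge0 ?mdist_ge0.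
  have dL : 2 * mdist u v <= L.
    by rewrite /L -addrA lerDl addr_ge0 ?mdist_ge0.
  have key : (1 - a) * L <= Q + a * (mdist x z + mdist y w).
    by rewrite /L /Q; lra.
  have tQ : mdist x z + mdist y w <= Q + L by rewrite /Q; lra.
  have Q0 : 0 <= Q by rewrite /Q !addr_ge0 ?mdist_ge0.
  have key2 : (1 - 2 * a) * L <= (1 + a) * Q by nra.
  have : (1 - 3 * a) * L <= Q.
    suff : (1 + a) * ((1 - 3 * a) * L) <= (1 + a) * Q.
      by rewrite ler_pM2l//; lra.
    apply: le_trans key2; rewrite mulrA ler_wpM2r//.
    by nra.
  by apply: le_trans; rewrite ler_wpM2r//; lra.
Qed.

End symmetric_sd2.

(** * The space of trapezoids *)

Section trap_space.
Variable R : realType.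
Local Notation T := (trap_space R).

Lemma finite_fresh_index (N : set T) : finite_set N ->
  exists k, ~ N (pu k) /\ ~ N (pv k).
Proof.
move=> /finite_seqP[s ->].
pose idx (x : T) := match x with pu k | pv k => k | _ => 0%N end.
exists (\max_(x <- s) idx x).+1; split=> xs.
all: by have := @leq_bigmax_seq _ s xpredT idx _ xs isT; rewrite ltnn.
Qed.

(** If neither u_k nor v_k is in N, then on N the distance to u_k is 2 except at
    the a_i, and the distance to v_k is 2 except at the b_i. The exceptional
    points a_i and b_j are themselves at distance 1, just like u_k and v_k. *)
Lemma trap_space_long_trapezoid : long_trapezoid T.
Proof.
move=> N e /finite_fresh_index[k [Nu Nv]] e0.
exists (pu k), (pv k); split=> // x y Nx Ny.
rewrite (@le_trans _ _ (mdist x y + mdist (pu k : T) (pv k)))//.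
  by rewrite -[leRHS]mul1r ler_wpM2r ?addr_ge0 ?mdist_ge0//; lra.
have dxu : mdist x (pu k : T) = if x is pa _ then 1 else 2.
  rewrite trap_mdistE /trap_dist; case: eqP => [xE|_].
    by rewrite xE in Nx.
  by case: x Nx => //= i Ni; case: eqP => // iE; rewrite iE in Ni.
have dyv : mdist y (pv k : T) = if y is pb _ then 1 else 2.
  rewrite trap_mdistE /trap_dist; case: eqP => [yE|_].
    by rewrite yE in Ny.
  by case: y Ny => //= i Ni; case: eqP => // iE; rewrite iE in Ni.
have duv : mdist (pu k : T) (pv k) = 1 by rewrite trap_mdistE /trap_dist/= eqxx.
have dxy : mdist x y <= 2.
  by rewrite trap_mdistE /trap_dist; do 2?case: ifP => _; lra.
rewrite duv dxu dyv; case: x y {Nx Ny dxu dyv} dxy => [i|i|i|i] [j|j|j|j] dxy.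
all: by rewrite ?[mdist (pa _ : T) (pb _)]trap_mdistE /trap_dist/=; lra.
Qed.

(** Every point is at distance 1 from both points of a pair which are at distance
    2 from each other: {a_1, a_2} for the b_i and u_k, {b_1, b_2} for the a_i
    and v_k. *)
Lemma trap_space_unit_neighbours (z : T) : exists x y : T,
  [/\ [set pa true; pa false; pb true; pb false] x,
      [set pa true; pa false; pb true; pb false] y,
      mdist x y = 2, mdist x z = 1 & mdist y z = 1].
Proof.
have a c : [set pa true; pa false; pb true; pb false] (pa c : T).
  by case: c; do ?[by right|left].
have b c : [set pa true; pa false; pb true; pb false] (pb c : T).
  by case: c; [left; right|right].
case: z => c.
- by exists (pb true), (pb false); split=> //; exact: b.
- by exists (pa true), (pa false); split=> //; exact: a.
- by exists (pa true), (pa false); split=> //; exact: a.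
- by exists (pb true), (pb false); split=> //; exact: b.
Qed.

(** With such pairs for u and v the right-hand side of the second inequality
    is 4, while distinct u and v are at distance at least 1, so that the
    left-hand side is at least 6 (1 - e). *)
Lemma trap_space_not_strong_long_trapezoid : ~ strong_long_trapezoid T.
Proof.
move=> /(_ [set pa true; pa false; pb true; pb false] 4^-1) [||u [v [uv _ H]]].
- by rewrite !finite_setU; do !split; exact: finite_set1.
- by rewrite invr_gt0.
have [x [y [Nx Ny xy xu yu]]] := trap_space_unit_neighbours u.
have [z [w [Nz Nw zw zv wv]]] := trap_space_unit_neighbours v.
have d1 : 1 <= mdist u v.
  rewrite trap_mdistE /trap_dist ifN; last exact/eqP.
  by case: ifP => _ //; lra.
by have := H x y z w Nx Ny Nz Nw; rewrite xy zw xu yu zv wv; lra.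
Qed.

End trap_space.

Theorem mainTheorem2 (R : realType) :
  [/\ long_trapezoid (trap_space R),
      ~ strong_long_trapezoid (trap_space R)
    & forall o : trap_space R,
        wstar_SD2P (lip0_dual o) /\ ~ wstar_SSD2P (lip0_dual o)].
Proof.
split; [exact: trap_space_long_trapezoid|
        exact: trap_space_not_strong_long_trapezoid|].
move=> o; split.
  exact/long_trapezoid_wstar_SD2P/trap_space_long_trapezoid.
move=> ssd; apply: (@trap_space_not_strong_long_trapezoid R).
exact: (@wstar_SSD2P_strong_long_trapezoid _ _ o (pa true) (pa false)) ssd.
Qed.
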